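(* Let $(T,d,\rho)$ be a rooted compact real tree and let $\leq_{\mathrm{Sh}}$ be the random uniform shuffling of $T$ (defined in the context). For any distinct elements $\sigma_1,\dots,\sigma_n$ of $T$, the random ordering of the set $\{\sigma_1,\dots,\sigma_n\}$ induced by $\leq_{\mathrm{Sh}}$ is uniformly distributed among the orderings of this set that are induced by linear orders on $T$ satisfying (Or1) and (Or2).
   Context: A real tree is a metric space $(T,d)$ in which any two points $\sigma,\sigma'$ are joined by a path isometric to $[0,d(\sigma,\sigma')]$, with image denoted $[\![\sigma,\sigma']\!]$, and such that every continuous injective $q:[0,1]\to T$ has image $[\![q(0),q(1)]\!]$. It is rooted if a point $\rho\in T$ is distinguished. The point $\sigma\wedge\sigma'$ is defined by $[\![\rho,\sigma\wedge\sigma']\!]=[\![\rho,\sigma]\!]\cap[\![\rho,\sigma']\!]$. $\mathrm{Br}(T)$ is the set (at most countable when $T$ is compact) of $\sigma\in T\setminus\{\rho\}$ such that $T\setminus\{\sigma\}$ has at least $3$ connected components. Conditions on a linear order $\leq$ on $T$: - (Or1): if $\sigma_1\in[\![\rho,\sigma_2]\!]$ then $\sigma_1\leq\sigma_2$; - (Or2): if $\sigma_1\leq\sigma_2\leq\sigma_3$, then $\gamma\in[\![\rho,\sigma_2]\!]$, where $\gamma$ is defined by $[\![\rho,\gamma]\!]=[\![\rho,\sigma_1]\!]\cap([\![\rho,\sigma_2]\!]\cup[\![\rho,\sigma_3]\!])$. For $\sigma\in T$, let $\mathcal{C}_\sigma$ be the (at most countable) set of connected components of $T\setminus\{\sigma\}$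 that do not contain $\rho$. Fix an index set $I_\sigma$ equal to $\emptyset$, $\{1,\dots,n\}$ or $\{1,2,\dots\}$, and a bijection $k\mapsto C_\sigma(k)$ from $I_\sigma$ onto $\mathcal{C}_\sigma$. Given linear orders $\mathbf{O}=\{\lhd_\sigma,\ \sigma\in\mathrm{Br}(T)\cup\{\rho\}\}$ on the sets $I_\sigma$, the (reflexive) relation $\lhd_{\mathbf{O}}$ on $T$ is defined for distinct $\sigma,\sigma'$ by: if $\sigma\wedge\sigma'\in\{\sigma,\sigma'\}$, then $\sigma\lhd_{\mathbf{O}}\sigma'$ if $\sigma\in[\![\rho,\sigma']\!]$ and $\sigma'\lhd_{\mathbf{O}}\sigma$ if $\sigma'\in[\![\rho,\sigma]\!]$; otherwise $\sigma\wedge\sigma'\in\mathrm{Br}(T)\cup\{\rho\}$, there are distinct $k,k'\in I_{\sigma\wedge\sigma'}$ with $\sigma\in C_{\sigma\wedge\sigma'}(k)$, $\sigma'\in C_{\sigma\wedge\sigma'}(k')$, and $\sigma\lhd_{\mathbf{O}}\sigma'$ if $k\lhd_{\sigma\wedge\sigma'}k'$, $\sigma'\lhd_{\mathbf{O}}\sigma$ if $k'\lhd_{\sigma\wedge\sigma'}k$. **Random uniform shuffling.** On a probability space $(\Omega,\mathcal{F},\mathbb{P})$ let $\{U_{\sigma,k}:\sigma\in\mathrm{Br}(T)\cup\{\rho\},\ k\in I_\sigma\}$ be a (countable) family of i.i.d. random variables uniformly distributed on $[0,1]$. Define (almost surely) linear orders $\lhd_\sigma$ on $I_\sigma$ by $k\lhd_\sigma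 l$ iff $U_{\sigma,k}\leq U_{\sigma,l}$, let $\mathbf{O}=\{\lhd_\sigma\}$ and set $\leq_{\mathrm{Sh}}\,=\,\lhd_{\mathbf{O}}$. *)

(* Defs.v *)
From HB Require Import structures.
From mathcomp Require Import all_boot all_order all_algebra.
From mathcomp Require Import all_classical all_reals all_analysis.

Set Implicit Arguments.
Unset Strict Implicit.
Unset Printing Implicit Defensive.

Import Order.TTheory GRing.Theory Num.Theory.
Import numFieldNormedType.Exports.

Local Open Scope classical_set_scope.
Local Open Scope ring_scope.

Section RealTree.
Context {R : realType} {T : metricType R}.
Implicit Types (x y z s rho : T).

(* Only the restriction of [f] to [0, d(x, y)] matters. *)
Definition geodesic x y (f : R -> T) : Prop :=
  [/\ f 0 = x, f (mdist x y) = y &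
      {in `[0, mdist x y] &, forall t u, mdist (f t) (f u) = `|t - u|}].

(* [[x, y]]; in a real tree all geodesics from x to y have the same image, so
   that the union is over a family of equal sets. *)
Definition segment x y : set T :=
  \bigcup_(f in geodesic x y) (f @` `[0, mdist x y]).

Definition real_tree : Prop :=
  (forall x y, exists f, geodesic x y f) /\
  (forall q : R -> T, {within `[0, 1], continuous q} ->
     {in `[0, 1] &, injective q} ->
     q @` `[0, 1] = segment (q 0) (q 1)).

(* The point g such that [[rho, g]] = S (and rho if there is no such point). *)
Definition tip rho (S : set T) : T := xget rho [set g | segment rho g = S].

Definition meet rho x y : T := tip rho (segment rho x `&` segment rho y).

Definition components s : set (set T) :=
  [set connected_component (~` [set s]) x | x in ~` [set s]].

Definition branch_points rho : set T :=
  [set s | s <> rho /\ (`I_3 #<= components s)%card].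

(* The family C_s of components of T \ {s} that avoid the root. *)
Definition components_off_root rho s : set (set T) :=
  [set A | components s A /\ ~ A rho].

Definition component_enum rho (I : T -> set nat) (C : T -> nat -> set T) :
    Prop :=
  forall s,
    ((exists n, I s = [set k | (1 <= k <= n)%N]) \/
     I s = [set k | (1 <= k)%N]) /\
    set_bij (I s) (components_off_root rho s) (C s).

Definition linear_order (le : T -> T -> Prop) : Prop :=
  [/\ forall x, le x x,
      forall x y, le x y -> le y x -> x = y,
      forall x y z, le x y -> le y z -> le x z &
      forall x y, le x y \/ le y x].

Definition Or1 rho (le : T -> T -> Prop) : Prop :=
  forall x1 x2, segment rho x2 x1 -> le x1 x2.

Definition Or2 rho (le : T -> T -> Prop) : Prop :=
  forall x1 x2 x3, le x1 x2 -> le x2 x3 ->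
    segment rho x2
      (tip rho (segment rho x1 `&` (segment rho x2 `|` segment rho x3))).

(* The relation induced on T by relations [O s] on the index sets [I s]. Only
   the values of [O] at rho and at the branch points are used, since in a real
   tree these are the possible values of [meet rho x y] when it differs from
   both x and y. *)
Definition shuffle rho (I : T -> set nat) (C : T -> nat -> set T)
    (O : T -> nat -> nat -> Prop) x y : Prop :=
  let m := meet rho x y in
  [\/ x = y,
      (m = x \/ m = y) /\ segment rho y x |
      [/\ m <> x, m <> y &
          exists k l, [/\ I m k /\ I m l, k <> l, C m k x, C m l y & O m k l]]].

(* The ordering induced on the points v 0, ..., v (n - 1), as a boolean
   relation on their indices. *)
Definition induced_ordering n (v : 'I_n -> T) (le : T -> T -> Prop) :
    {ffun 'I_n * 'I_n -> bool} :=
  [ffun p => `[< le (v p.1) (v p.2) >]].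

Definition admissible_orderings rho n (v : 'I_n -> T) :
    {set {ffun 'I_n * 'I_n -> bool}} :=
  finset (fun r => `[< exists le, [/\ linear_order le, Or1 rho le, Or2 rho le &
                                      r = induced_ordering v le] >]).

End RealTree.

Arguments real_tree {R} T.

Section Probability.
Context {d : measure_display} {Omega : measurableType d} {R : realType}.
Variable P : probability Omega R.

Definition mutually_independent (J : eqType) (D : set J)
    (X : J -> {RV P >-> R}) : Prop :=
  forall (js : seq J) (B : J -> set R),
    uniq js -> [set` js] `<=` D -> (forall j, measurable (B j)) ->
    P (\bigcap_(j in [set` js]) (X j @^-1` B j)) =
    (\prod_(j <- js) P (X j @^-1` B j))%E.

Definition iid_uniform01 (J : eqType) (D : set J) (X : J -> {RV P >-> R}) :
    Prop :=
  mutually_independent D X /\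
  (forall j, D j -> forall B : set R, measurable B ->
     distribution P (X j) B = uniform_prob (@ltr01 R) B).

(* X is a random variable uniformly distributed on the finite set A. Summing
   over all v shows that no such X exists when A is empty. *)
Definition uniformly_distributed (V : finType) (A : {set V}) (X : Omega -> V) :
    Prop :=
  forall v : V,
    measurable (X @^-1` [set v]) /\
    P (X @^-1` [set v]) = (if v \in A then (#|A|%:R^-1)%:E else 0%E).

(* The index set { (s, k) : s in Br(T) U {rho}, k in I_s }. *)
Definition shuffle_index (T : metricType R) (rho : T) (I : T -> set nat) :
    set (T * nat) :=
  [set sk | (branch_points rho sk.1 \/ sk.1 = rho) /\ I sk.1 sk.2].

Definition le_Sh (T : metricType R) (rho : T) (I : T -> set nat)
    (C : T -> nat -> set T) (U : T * nat -> {RV P >-> R}) (w : Omega) :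
    T -> T -> Prop :=
  shuffle rho I C (fun s k l => U (s, k) w <= U (s, l) w).

End Probability.

(* Main.v *)
From HB Require Import structures.
Require Import Defs.
From mathcomp Require Import all_boot all_order all_algebra.
From mathcomp Require Import all_classical all_reals all_analysis.
From mathcomp Require Import ring lra.

Set Implicit Arguments.
Unset Strict Implicit.

Local Open Scope classical_set_scope.

(** A real tree, rooted at [rho], is a tree order: the ancestors of a point form
a chain, any two points have a greatest common ancestor [meet rho x y], and two
points strictly above [s] lie in the same component of the complement of [s]
iff their meet is not [s].  All this follows from two facts about segments:
[[x, y]] is the set of points at which the triangle inequality between [x] and
[y] is an equality ([segmentP]), and any three points have a median
([median]).

In these terms the linear orders on the tree that satisfy (Or1) and (Or2) are
exactly the shuffles of linear orders, one for each point [s], on the indices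
of the components above [s].  A shuffle satisfies (Or2) by a case analysis on
the relative position of two forks ([shuffle_between]).  Conversely (Or2), which
says that [meet x z] is an ancestor of [y] whenever [x <= y <= z], forbids to
insert a point that forks off at [s] between two points of one component above
[s]; the order thus compares two components as a whole, which defines the
linear orders it is a shuffle of ([order_shuffle]).

Now fix finitely many points [v i].  Only the finitely many pairs [(s, k)]
collected in [keys] matter: those such that some [v i] and [v j] fork at [s]
and the component [k] contains [v i].  Two shuffles induce the same ordering of
the points iff for each [s] they agree on the keys over [s]
([induced_ordering_keys]).  Hence an admissible ordering is the same as a
family of linear orders on the sets of keys over each [s], and the event that
the random shuffling induces it says that the uniform variables of the keys
over each [s] are ranked in this way.  Given two such families, permuting the
keys over each [s] carries the one to the other; since independent identically
distributed variables have a joint law that is invariant under permutation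
([iid_reindex]), the two events have the same probability.  Almost surely there
are no ties between the variables of different keys ([iid_no_tie]), and then
the induced ordering is admissible.  So the admissible orderings are
equiprobable and carry all the mass. *)

(** * Segments of a real tree *)

Section RealTreeGeometry.
Import Order.TTheory GRing.Theory Num.Theory.
Import numFieldNormedType.Exports.
Local Open Scope ring_scope.

Context {R : realType} {T : metricType R}.
Implicit Types (x y z m s rho : T) (f g q : R -> T).

Lemma lipschitz_within_continuous (A : set R) q (K : R) :
  (forall t u, A t -> A u -> mdist (q t) (q u) <= K * `|t - u|) ->
  {within A, continuous q}.
Proof.
move=> hq; apply/subspace_continuousP => t At; apply/cvg_ballP => e e0.
pose K' := `|K| + 1; have K'0 : 0 < K' by rewrite /K' ltr_wpDl.
have eK : 0 < e / K' by rewrite divr_gt0.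
apply: (filterS _ (nbhsx_ballx t _ eK)) => u /= tu Au; rewrite ballEmdist /=.
apply: (le_lt_trans (hq _ _ At Au)).
apply: (@le_lt_trans _ _ (K' * `|t - u|)).
  by rewrite ler_wpM2r// /K' (le_trans (ler_norm _))// lerDl.
by rewrite mulrC -ltr_pdivlMr.
Qed.

Lemma geodesic_dist x y f t : geodesic x y f -> 0 <= t <= mdist x y ->
  mdist x (f t) = t /\ mdist (f t) y = mdist x y - t.
Proof.
case=> f0 f1 fd /andP[t0 t1]; split.
  rewrite -{1}f0 fd ?in_itv/= ?lexx ?t0 ?(le_trans t0)//.
  by rewrite sub0r normrN ger0_norm.
rewrite -{1}f1 fd ?in_itv/= ?lexx ?t0 ?(le_trans t0)//.
by rewrite distrC ger0_norm ?subr_ge0.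
Qed.

Lemma geodesic_segment x y f t : geodesic x y f -> 0 <= t <= mdist x y ->
  segment x y (f t).
Proof. by move=> gf ht; exists f => //; exists t => //=; rewrite in_itv. Qed.

Definition concat (a : R) f g (t : R) : T := if t <= a then f t else g (t - a).

Lemma concat_lipschitz x m y f g : geodesic x m f -> geodesic m y g ->
  let D := `[0, mdist x m + mdist m y] in
  {in D &, forall t u,
    mdist (concat (mdist x m) f g t) (concat (mdist x m) f g u) <= `|t - u|}.
Proof.
move=> gf gg D.
have key (t u : R) : 0 <= t -> u <= mdist x m + mdist m y -> t <= mdist x m ->
    mdist x m < u -> mdist (f t) (g (u - mdist x m)) <= u - t.
  move=> t0 u1 ta au.
  have [|_ h1] := @geodesic_dist _ _ _ t gf; first by rewrite t0.
  have [|h2 _] := @geodesic_dist _ _ _ (u - mdist x m) gg; first lra.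
  by have := metric_triangle (f t) m (g (u - mdist x m)); lra.
move=> t u; rewrite !in_itv /= => /andP[t0 t1] /andP[u0 u1]; rewrite /concat.
case: ifPn => ta; case: ifPn => ua.
- by case: gf => _ _ ->; rewrite ?in_itv/= ?t0 ?u0.
- rewrite -ltNge in ua; rewrite distrC ger0_norm; last lra.
  exact: key.
- rewrite -ltNge in ta; rewrite metric_sym ger0_norm; last lra.
  exact: key.
- rewrite -ltNge in ta; rewrite -ltNge in ua.
  case: gg => _ _ ->; rewrite ?in_itv/=; [|lra|lra].
  by rewrite (_ : t - _ - _ = t - u)//; ring.
Qed.

(** If [z] is between [x] and [y] for the distance, then geodesics from [x] to
[z] and from [z] to [y] concatenate to a geodesic: the concatenation is
1-Lipschitz and its length is the distance of its end points. *)
Lemma segmentP (hT : real_tree T) x y z :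
  segment x y z <-> mdist x z + mdist z y = mdist x y.
Proof.
split=> [[f gf [t /=]]|xzy].
  by rewrite in_itv /= => ht <-; have [-> ->] := geodesic_dist gf ht; ring.
have [f gf] := hT.1 x z; have [g gg] := hT.1 z y.
have xz0 := mdist_ge0 x z; have zy0 := mdist_ge0 z y.
set h := concat (mdist x z) f g.
have hz : h (mdist x z) = z by rewrite /h /concat lexx; case: gf.
suff gh : geodesic x y h by rewrite -hz; apply: geodesic_segment => //; lra.
have h0 : h 0 = x by rewrite /h /concat xz0; case: gf.
have h1 : h (mdist x y) = y.
  rewrite /h /concat; case: ifPn => [le|_].
    have zy : mdist z y = 0 by lra.
    rewrite (_ : mdist x y = mdist x z); last lra.
    by case: gf => _ -> _; exact: mdist_positivity.
  by rewrite -xzy addrAC subrr add0r; case: gg.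
split => //.
have lip := concat_lipschitz gf gg; rewrite /= xzy -/h in lip.
(* A pair of times contracted strictly would bring [x] and [y] closer. *)
have inc (t u : R) : 0 <= t -> t <= u -> u <= mdist x y -> mdist (h t) (h u) = u - t.
  move=> t0 tu u1; apply/eqP; rewrite eq_le; apply/andP; split.
    apply: (le_trans (lip t u _ _)); rewrite ?in_itv/=; [lra|lra|].
    by rewrite distrC ger0_norm; lra.
  have a1 : mdist x (h t) <= t.
    rewrite -{1}h0; apply: (le_trans (lip _ _ _ _)); rewrite ?in_itv/=; [lra|lra|].
    by rewrite sub0r normrN ger0_norm.
  have a2 : mdist (h u) y <= mdist x y - u.
    rewrite -{1}h1; apply: (le_trans (lip _ _ _ _)); rewrite ?in_itv/=; [lra|lra|].
    by rewrite distrC ger0_norm; lra.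
  have := metric_triangle x (h t) y; have := metric_triangle (h t) (h u) y.
  lra.
move=> t u; rewrite !in_itv /= => /andP[t0 t1] /andP[u0 u1].
have [tu|ut] := leP t u; first by rewrite inc// distrC ger0_norm; lra.
by rewrite metric_sym inc// 1?ltW// ger0_norm; lra.
Qed.

Lemma segment_refl_l (hT : real_tree T) x y : segment x y x.
Proof. by apply/(segmentP hT); rewrite mdistxx add0r. Qed.

Lemma segment_refl_r (hT : real_tree T) x y : segment x y y.
Proof. by apply/(segmentP hT); rewrite mdistxx addr0. Qed.

Lemma segment_sym (hT : real_tree T) x y z : segment x y z -> segment y x z.
Proof.
move/(segmentP hT) => h; apply/(segmentP hT).
by rewrite addrC (metric_sym y x) -h (metric_sym z x) (metric_sym y z).
Qed.

(** The axiom on injective paths, applied to the geodesic run at constant speed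
on [0, 1]; this makes geodesics unique. *)
Lemma geodesic_image (hT : real_tree T) x y f : geodesic x y f ->
  f @` `[0, mdist x y] = segment x y.
Proof.
move=> gf; have [xy|xy] := eqVneq x y.
  apply/seteqP; split=> [_ [t ht <-]|z]; first by apply: geodesic_segment.
  move/(segmentP hT); rewrite xy mdistxx => h.
  have yz : mdist y z = 0 by have := mdist_ge0 y z; have := mdist_ge0 z y; lra.
  exists 0; first by rewrite /= in_itv /= lexx.
  by case: gf => -> _ _; rewrite xy; exact: mdist_positivity.
have d0 : 0 < mdist x y by rewrite mdist_gt0.
pose q t := f (t * mdist x y).
have q0 : q 0 = x by rewrite /q mul0r; case: gf.
have q1 : q 1 = y by rewrite /q mul1r; case: gf.
have qd (t u : R) : `[0, 1]%classic t -> `[0, 1]%classic u ->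
    mdist (q t) (q u) = mdist x y * `|t - u|.
  rewrite /= !in_itv /= => /andP[t0 t1] /andP[u0 u1].
  case: gf => _ _ ->; rewrite ?in_itv/=; last 2 first.
  - by rewrite mulr_ge0 ?(ltW d0)// ger_pMl.
  - by rewrite mulr_ge0 ?(ltW d0)// ger_pMl.
  by rewrite -mulrBl normrM (ger0_norm (ltW d0)) mulrC.
have := hT.2 q; rewrite q0 q1 => <-.
- apply/seteqP; split=> [_ [t /=] + <-|_ [t /=] + <-];
    rewrite in_itv /= => /andP[t0 t1].
    exists (t / mdist x y); last by rewrite /q divfK// gt_eqF.
    by rewrite /= in_itv /= divr_ge0 ?(ltW d0)//= ler_pdivrMr// mul1r.
  exists (t * mdist x y) => //.
  by rewrite /= in_itv /= mulr_ge0 ?(ltW d0)//= ger_pMl.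
- by apply: (@lipschitz_within_continuous _ _ (mdist x y)) => t u At Au; rewrite qd.
- move=> t u At Au qtu; apply/eqP; rewrite -subr_eq0 -normr_eq0.
  have := qd _ _ At Au; rewrite qtu mdistxx => /esym/eqP.
  by rewrite mulf_eq0 gt_eqF.
Qed.

Lemma tree_segment_connected (hT : real_tree T) x y : connected (segment x y).
Proof.
have [f gf] := hT.1 x y; rewrite -(geodesic_image hT gf).
apply: connected_continuous_connected; first exact: segment_connected.
apply: (@lipschitz_within_continuous _ _ 1) => t u; case: gf => _ _ fd At Au.
by rewrite fd// mul1r.
Qed.

(** Two segments that meet only at their common end point form an injective
path, so that the axiom on such paths turns it into a segment.  This is where
the absence of cycles enters. *)
Lemma segment_concat (hT : real_tree T) x m y :
  (forall z, segment x m z -> segment m y z -> z = m) -> segment x y m.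
Proof.
move=> hm; have [f gf] := hT.1 x m; have [g gg] := hT.1 m y.
have a0 := mdist_ge0 x m; have b0 := mdist_ge0 m y.
set h := concat (mdist x m) f g; set D := mdist x m + mdist m y.
have [D0|D0] := eqVneq D 0.
  have -> : x = m by apply: mdist_positivity; rewrite /D in D0; lra.
  exact: segment_refl_l.
have {}D0 : 0 < D by rewrite lt_def D0 addr_ge0.
have lip := concat_lipschitz gf gg; rewrite /= -/D -/h in lip.
pose q t := h (t * D).
have q0 : q 0 = x by rewrite /q mul0r /h /concat a0; case: gf.
have q1 : q 1 = y.
  rewrite /q mul1r /h /concat; case: ifPn => [le|_].
    have my : mdist m y = 0 by rewrite /D in le; lra.
    rewrite (_ : D = mdist x m); last by rewrite /D; lra.
    by case: gf => _ -> _; exact: mdist_positivity.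
  by rewrite /D addrAC subrr add0r; case: gg.
have qm : q (mdist x m / D) = m.
  by rewrite /q divfK ?gt_eqF// /h /concat lexx; case: gf.
have scale (t : R) : `[0, 1]%classic t -> 0 <= t * D <= D.
  rewrite /= in_itv /= => /andP[t0 t1].
  by rewrite mulr_ge0 ?(ltW D0)//= ger_pMl.
have := hT.2 q; rewrite q0 q1 => <-.
- exists (mdist x m / D) => //.
  by rewrite /= in_itv/= divr_ge0// ?(ltW D0)//= ler_pdivrMr// mul1r /D lerDl.
- apply: (@lipschitz_within_continuous _ _ D) => t u At Au.
  apply: (le_trans (lip _ _ _ _)); rewrite ?in_itv/= ?scale//.
  by rewrite -mulrBl normrM (ger0_norm (ltW D0)) mulrC.
- have key (t u : R) : 0 <= t -> u <= D -> t <= mdist x m -> mdist x m < u ->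
      f t = g (u - mdist x m) -> t = u.
    move=> t0 u1 ta au e.
    have ht : 0 <= t <= mdist x m by rewrite t0.
    have hu : 0 <= u - mdist x m <= mdist m y by rewrite /D in u1; lra.
    have gm : g (u - mdist x m) = m.
      by apply: hm; [rewrite -e|]; apply: geodesic_segment.
    have [_] := geodesic_dist gf ht; have [+ _] := geodesic_dist gg hu.
    rewrite e gm !mdistxx; lra.
  suff inj (t u : R) : 0 <= t <= D -> 0 <= u <= D -> h t = h u -> t = u.
    move=> t u At Au /inj -/(_ (scale _ At) (scale _ Au)).
    by apply: mulIf; rewrite gt_eqF.
  move=> /andP[t0 t1] /andP[u0 u1]; rewrite /h /concat.
  case: ifPn => ta; case: ifPn => ua.
  + have ht : 0 <= t <= mdist x m by rewrite t0.
    have hu : 0 <= u <= mdist x m by rewrite u0.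
    have [+ _] := geodesic_dist gf ht; have [+ _] := geodesic_dist gf hu.
    by move=> eu et e; rewrite -eu -et e.
  + by rewrite -ltNge in ua; apply: key.
  + by rewrite -ltNge in ta; move=> e; apply/esym; apply: key.
  + rewrite -!ltNge in ta ua.
    have ht : 0 <= t - mdist x m <= mdist m y by rewrite /D in t1; lra.
    have hu : 0 <= u - mdist x m <= mdist m y by rewrite /D in u1; lra.
    have [+ _] := geodesic_dist gg ht; have [+ _] := geodesic_dist gg hu.
    by move=> eu et e; rewrite e in et; lra.
Qed.

End RealTreeGeometry.

(** * Medians, meets and components *)

Section TreeGeometry.
Import Order.TTheory GRing.Theory Num.Theory.
Import numFieldNormedType.Exports.
Local Open Scope ring_scope.

Context {R : realType} {T : metricType R} (hT : real_tree T).
Implicit Types (x y z w m s rho : T).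

Let segP x y z : segment x y z <-> mdist x z + mdist z y = mdist x y.
Proof. exact: segmentP. Qed.

Lemma segment_geodesic x y z f : geodesic x y f -> segment x y z ->
  z = f (mdist x z).
Proof.
move=> gf; rewrite -(geodesic_image hT gf) => -[t /=].
by rewrite in_itv => ht <-; have [-> _] := geodesic_dist gf ht.
Qed.

(** The last point of [[x, y]] that lies on [[x, z]] separates the three end
points: beyond it the segments to [y] and to [z] are disjoint, so that they
concatenate to [[y, z]]. *)
Lemma median x y z :
  exists m, [/\ segment x y m, segment x z m & segment y z m].
Proof.
have [f gf] := hT.1 x y.
pose S := [set t : R | 0 <= t <= mdist x y /\ segment x z (f t)].
have S0 : S 0.
  split; first by rewrite lexx mdist_ge0.
  by case: gf => -> _ _; exact: segment_refl_l.
have Sub : has_ubound S by exists (mdist x y) => t [/andP[]].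
have hS : has_sup S by split => //; exists 0.
pose t0 := sup S.
have ht0 : 0 <= t0 <= mdist x y.
  rewrite ub_le_sup//= ge_sup//; first by exists 0.
  by move=> t [/andP[]].
have xz : segment x z (f t0).
  apply/segP/eqP; rewrite eq_le metric_triangle andbT.
  apply/ler_addgt0Pr => e e0.
  have [t St te] := sup_adherent (divr_gt0 e0 (ltr0n R 2)) hS.
  have tt0 : t <= t0 by exact: ub_le_sup.
  have [ht /segP fz] := St.
  have ftt : mdist (f t) (f t0) = t0 - t.
    case: gf => _ _ ->; rewrite ?in_itv//=.
    by rewrite distrC ger0_norm ?subr_ge0.
  have := metric_triangle x (f t) (f t0); have := metric_triangle (f t0) (f t) z.
  rewrite (metric_sym (f t0) (f t)); rewrite -/t0 in te; lra.
have xy : segment x y (f t0) by exact: geodesic_segment.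
have [e0 e1] := geodesic_dist gf ht0.
exists (f t0); split => //; apply: (segment_concat hT) => w wy wz.
move: wy wz xz xy => /segP wy /segP wz /segP xz /segP xy.
have t1 := metric_triangle x (f t0) w; have t2 := metric_triangle x w y.
have t3 := metric_triangle x w z.
have s1 := metric_sym y w; have s2 := metric_sym (f t0) w.
have s3 := metric_sym y (f t0).
have wxy : segment x y w by apply/segP; lra.
have wxz : segment x z w by apply/segP; lra.
have Sw : S (mdist x w).
  split; first by rewrite mdist_ge0; move/segP : wxy; have := mdist_ge0 w y; lra.
  by rewrite -(segment_geodesic gf wxy).
have := ub_le_sup Sub Sw; rewrite -/t0 => le; apply: mdist_positivity.
have := mdist_ge0 w (f t0); lra.
Qed.

Lemma segment_trans x y z w : segment x z y -> segment x w z -> segment x w y.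
Proof.
move=> /segP h1 /segP h2; apply/segP.
have := metric_triangle y z w; have := metric_triangle x y w; lra.
Qed.

Lemma segment_antisym x y z : segment x y z -> segment x z y -> y = z.
Proof.
move=> /segP h1 /segP h2; apply: mdist_positivity.
by have := metric_sym y z; lra.
Qed.

Lemma segment_chain x y z w : segment x w y -> segment x w z ->
  segment x z y \/ segment x y z.
Proof.
have [f gf] := hT.1 x w => hy hz.
have ey := segment_geodesic gf hy; have ez := segment_geodesic gf hz.
move/segP in hy; move/segP in hz.
have d : mdist y z = `|mdist x y - mdist x z|.
  rewrite {1}ey {1}ez; case: gf => _ _ ->; rewrite ?in_itv//=.
  - by rewrite mdist_ge0; have := mdist_ge0 y w; lra.
  - by rewrite mdist_ge0; have := mdist_ge0 z w; lra.
have [le|lt] := leP (mdist x y) (mdist x z); [left|right]; apply/segP.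
  by rewrite d distrC ger0_norm; lra.
by rewrite metric_sym in d; rewrite d ger0_norm; lra.
Qed.

(** Triangles are tripods: with [m] the median, a point of [[x, z]] is on the
side [[x, m]] or on the side [[m, z]]. *)
Lemma segment_cover x y z w : segment x z w -> segment x y w \/ segment y z w.
Proof.
move=> hw; have [m [xy xz yz]] := median x y z.
have [wm|mw] := segment_chain hw xz; first by left; exact: segment_trans xy.
right; move: hw xz yz mw => /segP hw /segP xz /segP yz /segP mw.
apply/segP; have := metric_triangle m w z; have := metric_triangle y m w.
have := metric_triangle y w z; lra.
Qed.

Lemma tip_segment rho x : tip rho (segment rho x) = x.
Proof.
have h : exists g, [set g | segment rho g = segment rho x] g by exists x.
have : segment rho (tip rho (segment rho x)) = segment rho x.
  exact: (xgetPex rho h).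
move: (tip _ _) => t e.
apply: (@segment_antisym rho).
- by rewrite e; exact: segment_refl_r.
- by rewrite -e; exact: segment_refl_r.
Qed.

(** The median of [rho], [x] and [y] is the greatest common ancestor of [x] and
[y]: a common ancestor beyond it would make [d(x, y)] too small. *)
Lemma meet_spec rho x y : segment x y (meet rho x y) /\
  segment rho (meet rho x y) = segment rho x `&` segment rho y.
Proof.
have [m [mx my mxy]] := median rho x y.
suff e : segment rho m = segment rho x `&` segment rho y.
  by rewrite /meet -e tip_segment.
apply/seteqP; split=> [z zm|z [zx zy]].
  by split; exact: segment_trans zm _.
have [//|mz] := segment_chain zx mx.
move: mx my mxy zx zy mz => /segP mx /segP my /segP mxy /segP zx /segP zy /segP mz.
have -> : m = z.
  apply: mdist_positivity; have := metric_triangle x z y.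
  have := mdist_ge0 m z.
  have := metric_sym x z; have := metric_sym x m; lra.
exact: segment_refl_r.
Qed.

Lemma meet_segment rho x y : segment x y (meet rho x y).
Proof. by have [] := meet_spec rho x y. Qed.

Lemma meetP rho x y z :
  segment rho (meet rho x y) z <-> segment rho x z /\ segment rho y z.
Proof. by have [_ ->] := meet_spec rho x y. Qed.

Lemma segment_meet rho x y s : segment rho x s -> segment rho y s ->
  (segment x y s <-> meet rho x y = s).
Proof.
move=> sx sy; split=> [sxy|<-]; last exact: meet_segment.
have mxy := meet_segment rho x y.
have [mx my] := (meetP rho x y (meet rho x y)).1 (segment_refl_r hT _ _).
have sm := (meetP rho x y s).2 (conj sx sy).
move: sx sy sxy mx my mxy sm.
move=> /segP sx /segP sy /segP sxy /segP mx /segP my /segP mxy /segP sm.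
apply/esym/mdist_positivity; have := metric_sym x s.
have := metric_sym x (meet rho x y); lra.
Qed.

(** A point of the open ball of radius [d(y, s)] around [y] is not separated
from [y] by [s], so that [s] separates both or neither from a third point. *)
Lemma separated_nbhs x y s : y <> s ->
  \forall y' \near y, y' <> s /\ (segment x y' s <-> segment x y s).
Proof.
move=> ys; have d0 : 0 < mdist y s by rewrite mdist_gt0; exact/eqP.
apply: (filterS _ (nbhsx_ballx y _ d0)) => y'; rewrite ballEmdist /= => yy'.
have nyy' : ~ segment y y' s by move/segP; have := mdist_ge0 s y'; lra.
split=> [y's|]; first by rewrite y's ltxx in yy'.
split=> /(@segment_cover x) h.
  by have [] := h y.
by have [] := h y' => // /(segment_sym hT).
Qed.

(** Segments are connected, and by [separated_nbhs] being separated by [s] from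
[x] is an open and closed condition in the complement of [s]. *)
Lemma component_segment s x : x <> s ->
  connected_component (~` [set s]) x = [set y | y <> s /\ ~ segment x y s].
Proof.
move=> xs; apply/seteqP; split=> [y|y [ys nxy]]; last first.
  exists (segment x y); last exact: segment_refl_r.
  split; first exact: segment_refl_l.
    by move=> z zxy /= zs; apply: nxy; rewrite -zs.
  exact: tree_segment_connected.
move=> [D [Dx Ds Dc] Dy]; split; first exact: Ds.
pose E := [set y | y <> s /\ ~ segment x y s].
suff DE : D `&` E = D by move: Dy; rewrite -DE => -[_ []].
apply: Dc.
- exists x; split => //; split => // /segP; rewrite mdistxx => h.
  apply: xs; apply: mdist_positivity.
  by have := mdist_ge0 x s; have := mdist_ge0 s x; lra.
- exists E => //; rewrite openE => z [zs nz]; rewrite /interior.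
  by apply: filterS (separated_nbhs x zs) => z' [? ?]; split => //; tauto.
- exists (~` [set y | y <> s /\ segment x y s]).
    apply: open_closedC; rewrite openE => z [zs xz]; rewrite /interior.
    by apply: filterS (separated_nbhs x zs) => z' [? ?]; split => //; tauto.
  apply/seteqP; split=> z [Dz] /= h; split => //; first by move=> []; case: h.
  by split; [exact: Ds|move=> ?; apply: h; split => //; exact: Ds].
Qed.

End TreeGeometry.

(** * Orders on the tree *)

(** Breaking the ties of a total preorder by the order of the integers yields a
linear order on all of [nat], not only where there are no ties. *)
Definition tiebreak (Q : rel nat) : rel nat :=
  fun k l => Q k l && (Q l k ==> (k <= l)%N).

Definition linear_rel (Q : rel nat) : Prop :=
  [/\ antisymmetric Q, transitive Q & total Q].

Lemma tiebreak_linear (Q : rel nat) :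
  transitive Q -> total Q -> linear_rel (tiebreak Q).
Proof.
move=> Qt Qtot; rewrite /tiebreak; split.
- move=> k l /andP[/andP[kl /implyP hkl] /andP[lk /implyP hlk]].
  by apply/eqP; rewrite eqn_leq hkl// hlk.
- move=> l k p /andP[kl hkl] /andP[lp hlp]; rewrite (Qt _ _ _ kl lp) /=.
  apply/implyP => pk; apply: (@leq_trans l).
    by apply: (implyP hkl); exact: Qt lp pk.
  by apply: (implyP hlp); exact: Qt pk kl.
- move=> k l; have := Qtot k l; have := leq_total k l.
  by case: (Q k l); case: (Q l k) => //=; rewrite ?orbT.
Qed.

Section TreeOrders.
Context {R : realType} {T : metricType R} (hT : real_tree T) (rho : T).
Context (I : T -> set nat) (C : T -> nat -> set T) (hC : component_enum rho I C).
Implicit Types (x y z m s : T) (O : T -> rel nat) (le : T -> T -> Prop).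

Local Notation "x <~ y" := (segment rho y x) (at level 70).

Let anc_trans y x z : x <~ y -> y <~ z -> x <~ z.
Proof. by move=> xy yz; exact: (segment_trans hT xy yz). Qed.

Let anc_antisym x y : x <~ y -> y <~ x -> x = y.
Proof. by move=> xy yx; exact: (segment_antisym hT yx xy). Qed.

Lemma meet_sym x y : meet rho x y = meet rho y x.
Proof. by rewrite /meet setIC. Qed.

Lemma meet_anc_l x y : meet rho x y <~ x.
Proof. by have [] := (meetP hT rho x y _).1 (segment_refl_r hT _ _). Qed.

Lemma meet_anc_r x y : meet rho x y <~ y.
Proof. by rewrite meet_sym; exact: meet_anc_l. Qed.

Lemma meet_anc x y : x <~ y -> meet rho x y = x.
Proof.
move=> xy; apply: anc_antisym; first exact: meet_anc_l.
by apply/(meetP hT); split => //; exact: segment_refl_r.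
Qed.

(** The pairs on which a shuffle depends on the order chosen at [s]. *)
Definition fork s x y : Prop := [/\ meet rho x y = s, s <> x & s <> y].

Lemma fork_sym s x y : fork s x y -> fork s y x.
Proof. by case=> h ? ?; rewrite /fork meet_sym. Qed.

Lemma fork_anc s x y : fork s x y -> s <~ x /\ s <~ y.
Proof. by case=> <- _ _; split; [exact: meet_anc_l|exact: meet_anc_r]. Qed.

Lemma fork_incomparable s x y : fork s x y -> ~ x <~ y.
Proof. by case=> h sx _ /meet_anc; rewrite h. Qed.

Lemma fork_or_anc x y : [\/ x <~ y, y <~ x | fork (meet rho x y) x y].
Proof.
have [h|h] := eqVneq (meet rho x y) x.
  by apply: Or31; rewrite -{1}h; exact: meet_anc_r.
have [h'|h'] := eqVneq (meet rho x y) y.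
  by apply: Or32; rewrite -{1}h'; exact: meet_anc_l.
by apply: Or33; split => //; exact/eqP.
Qed.

Definition class s x : nat := xget 0%N [set k | I s k /\ C s k x].

Lemma component_of_class s k x : I s k -> C s k x ->
  C s k = connected_component (~` [set s]) x.
Proof.
move=> Ik Cx; have [_ [Cfun _ _]] := hC s.
have [[z zs e] _] := Cfun k Ik.
by rewrite -e in Cx *; exact: same_connected_component.
Qed.

Lemma class_anc s k x : I s k -> C s k x -> s <~ x /\ s <> x.
Proof.
move=> Ik Cx; have e := component_of_class Ik Cx.
have [_ [Cfun _ _]] := hC s; have [_ nrho] := Cfun k Ik.
have sx : x <> s by rewrite e in Cx; have := connected_component_sub Cx.
split; last by apply/nesym.
rewrite e (component_segment hT sx) /= in nrho.
apply: contrapT => nsx; apply: nrho; split.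
  by move=> sr; apply: nsx; rewrite -sr; exact: segment_refl_l.
by move/(segment_sym hT).
Qed.

Lemma classP s x : s <~ x -> s <> x -> I s (class s x) /\ C s (class s x) x.
Proof.
move=> sx /nesym xs; have [_ [_ _ Csurj]] := hC s.
suff h : exists k, [set k | I s k /\ C s k x] k by have := xgetPex 0%N h.
have [|k Ik e] := Csurj (connected_component (~` [set s]) x).
  split; first by exists x.
  by rewrite (component_segment hT xs) => -[_]; apply; exact: segment_sym.
by exists k; split => //; rewrite e; exact: connected_component_refl.
Qed.

Lemma class_unique s k x : I s k -> C s k x -> k = class s x.
Proof.
move=> Ik Cx; have [sx xs] := class_anc Ik Cx; have [Il Cl] := classP sx xs.
have [_ [_ Cinj _]] := hC s; apply: Cinj; rewrite ?inE//.
by rewrite (component_of_class Ik Cx) (component_of_class Il Cl).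
Qed.

(** Both sides say that [s] does not separate [x] from [y]. *)
Lemma class_meet s x y : s <~ x -> s <~ y -> s <> x -> s <> y ->
  class s x = class s y <-> meet rho x y <> s.
Proof.
move=> sx sy xs ys; have [Ik Cx] := classP sx xs; have [Il Cy] := classP sy ys.
have e := component_segment hT (nesym xs).
rewrite -(segment_meet hT sx sy); split=> [k|nxy].
  move: Cy; rewrite -k (component_of_class Ik Cx) e.
  by case.
apply: class_unique => //; rewrite (component_of_class Ik Cx) e.
by split => //; exact: nesym.
Qed.

Lemma fork_class s x y : fork s x y -> class s x <> class s y.
Proof.
move=> f; have [sx sy] := fork_anc f; case: f => m xs ys.
by rewrite (class_meet sx sy).
Qed.

Lemma class_fork s x y : s <~ x -> s <~ y -> s <> x -> s <> y ->
  class s x <> class s y -> fork s x y.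
Proof.
by move=> sx sy xs ys; rewrite (class_meet sx sy)// => /contrapT m; split.
Qed.

(** Forking at [s] only depends on the components above [s]. *)
Lemma fork_move s x x' y : fork s x y -> s <~ x' -> s <> x' ->
  meet rho x x' <> s -> class s x' = class s x /\ fork s x' y.
Proof.
move=> f sx' xs' m; have [sx sy] := fork_anc f; have nc := fork_class f.
case: f => _ xs ys.
have k : class s x = class s x' by apply/class_meet.
by split => //; apply: class_fork => //; rewrite -k.
Qed.

Lemma shuffle_fork (O : T -> nat -> nat -> Prop) s x y : fork s x y ->
  shuffle rho I C O x y <-> O s (class s x) (class s y).
Proof.
move=> f; have [sx sy] := fork_anc f; have nc := fork_class f.
have nxy := fork_incomparable f; case: f => m xs ys.
rewrite /shuffle m; split=> [[xy|[_ /nxy//]|[_ _ [k [l [[Ik Il] _ Cx Cy]]]]]|Okl].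
- by case: nxy; rewrite xy; exact: segment_refl_r.
- by rewrite (class_unique Ik Cx) (class_unique Il Cy).
- have [? ?] := classP sx xs; have [? ?] := classP sy ys.
  by apply: Or33; split => //; exists (class s x), (class s y); split.
Qed.

Lemma shuffle_anc (O : T -> nat -> nat -> Prop) x y :
  x <~ y -> shuffle rho I C O x y.
Proof. by move=> xy; apply: Or32; split => //; left; exact: meet_anc. Qed.

Lemma shuffle_cases (O : T -> nat -> nat -> Prop) x y :
  shuffle rho I C O x y -> x <~ y \/ fork (meet rho x y) x y.
Proof.
case=> [->|[]//|[? ? _]]; [|by left|by right].
by left; exact: segment_refl_r.
Qed.

(** In the definition of (Or2), the point [gamma] is the higher of [meet x y] and
[meet x z], both being ancestors of [x].  As [meet x y] is an ancestor of [y]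
anyway, the condition only bears on [meet x z]. *)
Lemma Or2P le : Or2 rho le <->
  forall x y z, le x y -> le y z -> meet rho x z <~ y.
Proof.
suff key x y z : meet rho x z <~ y <->
    segment rho y (tip rho (segment rho x `&` (segment rho y `|` segment rho z))).
  by split=> h x y z xy yz; apply/key; exact: h xy yz.
have [_ exy] := meet_spec hT rho x y; have [_ exz] := meet_spec hT rho x z.
rewrite setIUr -exy -exz.
have sub u v : u <~ v -> segment rho u `<=` segment rho v.
  by move=> uv w wu; exact: anc_trans wu uv.
have [h|h] := segment_chain hT (meet_anc_l x y) (meet_anc_l x z).
  by rewrite (setUidr (sub _ _ h)) (tip_segment hT).
rewrite (setUidl (sub _ _ h)) (tip_segment hT); split=> _.
  exact: meet_anc_r.
by apply: anc_trans h _; exact: meet_anc_r.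
Qed.

Section Shuffle.
Context (O : T -> rel nat) (hO : forall s, linear_rel (O s)).

Local Notation leO := (shuffle rho I C (fun s k l => O s k l)).

(** Transitivity and (Or2) at once.  If [x] forks from [y] at [a] and [y] from
[z] at [b], then [a] and [b] are comparable as ancestors of [y], and [x] forks
from [z] at the lower of the two: there the component of [y] is that of [x] or
that of [z], unless [a = b], where the order on the components is transitive.
The cases without one of the forks are similar. *)
Lemma shuffle_between x y z : leO x y -> leO y z ->
  leO x z /\ meet rho x z <~ y.
Proof.
have forked s x' z' : fork s x' z' -> O s (class s x') (class s z') ->
    s <~ y -> leO x' z' /\ meet rho x' z' <~ y.
  by move=> f Oxz sy; split; [exact/(shuffle_fork _ f)|case: f => ->].
move=> lxy lyz; case: (shuffle_cases lxy) (shuffle_cases lyz) => [xy|fa].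
  case=> [yz|fb].
    split; first exact/shuffle_anc/(anc_trans xy).
    by apply: anc_trans xy; exact: meet_anc_l.
  have Ob := (shuffle_fork _ fb).1 lyz; have [by_ bz] := fork_anc fb.
  have [xb|bx] := segment_chain hT xy by_.
    split; first exact/shuffle_anc/(anc_trans xb).
    by apply: anc_trans xy; exact: meet_anc_l.
  have [<-|/eqP bx'] := eqVneq (meet rho y z) x.
    split; first exact: shuffle_anc.
    by apply: anc_trans (meet_anc_l _ _) by_.
  have [|k f] := fork_move fb bx bx'.
    by rewrite meet_sym meet_anc//; exact: nesym.
  by apply: (forked _ _ _ f) => //; rewrite k.
have Oa := (shuffle_fork _ fa).1 lxy; have [ax ay] := fork_anc fa.
have far := fork_sym fa; have [_ ya xa] := far.
move: fa far Oa ax ay ya xa; set a := meet rho x y => fa far Oa ax ay ya xa.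
case=> [yz|fb].
  have az : a <~ z := anc_trans ay yz.
  have az' : a <> z.
    by move=> e; apply: ya; apply: anc_antisym => //; rewrite e.
  have [|k f] := fork_move far az az'.
    by rewrite meet_anc//; exact: nesym.
  by apply: (forked _ _ _ (fork_sym f)) => //; rewrite k.
have Ob := (shuffle_fork _ fb).1 lyz; have [by_ bz] := fork_anc fb.
have [_ yb zb] := fb.
move: fb Ob by_ bz yb zb; set b := meet rho y z => fb Ob by_ bz yb zb.
have [anti trans tot] := hO a.
have [ab|/eqP ab] := eqVneq a b.
  rewrite -ab in fb Ob by_ bz yb zb.
  apply: (forked a) => //; last exact: trans Oa Ob.
  apply: class_fork => // k; case: (fork_class fb).
  by apply: anti; rewrite Ob -k.
have [ab'|ba] := segment_chain hT ay by_; last first.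
  have bx : b <~ x := anc_trans ba ax.
  have bx' : b <> x.
    by move=> e; apply: ab; apply: anc_antisym => //; rewrite e.
  have [|k f] := fork_move fb bx bx'; first by rewrite meet_sym.
  by apply: (forked _ _ _ f) => //; rewrite k.
have az : a <~ z := anc_trans ab' bz.
have az' : a <> z.
  by move=> e; apply: ab; apply: anc_antisym => //; rewrite e.
have [|k f] := fork_move far az az'; first exact: nesym.
by apply: (forked _ _ _ (fork_sym f)) => //; rewrite k.
Qed.

Lemma shuffle_linear : linear_order leO.
Proof.
split.
- by move=> x; apply: Or31.
- move=> x y lxy lyx.
  case: (shuffle_cases lxy) (shuffle_cases lyx) => [xy [yx|f]|f].
  + exact: anc_antisym.
  + by have := fork_incomparable (fork_sym f).
  + case=> [yx|_]; first by have := fork_incomparable (fork_sym f).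
    have [anti _ _] := hO (meet rho x y); case: (fork_class f).
    apply: anti; rewrite ((shuffle_fork _ f).1 lxy).
    by rewrite ((shuffle_fork _ (fork_sym f)).1 lyx).
- by move=> x y z xy yz; have [] := shuffle_between xy yz.
- move=> x y; case: (fork_or_anc x y) => [xy|yx|f].
  + by left; exact: shuffle_anc.
  + by right; exact: shuffle_anc.
  + have [_ _ tot] := hO (meet rho x y).
    have [h|h] := orP (tot (class (meet rho x y) x) (class (meet rho x y) y)).
      by left; exact/(shuffle_fork _ f).
    by right; exact/(shuffle_fork _ (fork_sym f)).
Qed.

Lemma shuffle_Or1 : Or1 rho leO.
Proof. by move=> x y; exact: shuffle_anc. Qed.

Lemma shuffle_Or2 : Or2 rho leO.
Proof. by apply/Or2P => x y z xy yz; have [] := shuffle_between xy yz. Qed.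

End Shuffle.

Section Converse.
Context (le : T -> T -> Prop).
Context (hle : linear_order le) (h1 : Or1 rho le) (h2 : Or2 rho le).

(** If [x <= y <= x'], then (Or2) makes [meet x x'] an ancestor of [y], hence of
[meet x y = s]; but points of one component above [s] meet strictly above
[s]. *)
Lemma Or2_fork_move_l s x x' y : fork s x y -> s <~ x' -> s <> x' ->
  meet rho x x' <> s -> le x y -> le x' y.
Proof.
move=> f sx' xs' m lxy; have [_ _ _ tot] := hle.
case: (tot x' y) => // lyx'; case: m.
have mxy := (Or2P le).1 h2 _ _ _ lxy lyx'; have [sx sy] := fork_anc f.
case: f => e _ _; apply: anc_antisym; last by apply/(meetP hT).
by rewrite -e; apply/(meetP hT); split => //; exact: meet_anc_l.
Qed.

Lemma Or2_fork_move_r s x y y' : fork s x y -> s <~ y' -> s <> y' ->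
  meet rho y y' <> s -> le x y -> le x y'.
Proof.
move=> f sy' ys' m lxy; have [_ _ _ tot] := hle.
case: (tot x y') => // ly'x; case: m.
have mxy := (Or2P le).1 h2 _ _ _ ly'x lxy; have [sx sy] := fork_anc f.
rewrite meet_sym.
case: f => e _ _; apply: anc_antisym; last by apply/(meetP hT).
by rewrite -e; apply/(meetP hT); split => //; exact: meet_anc_r.
Qed.

Definition representative s k : T := xget rho (C s k).

(** Comparing representatives is a linear order on the indices in [I s]; breaking
ties makes it one on [nat]. *)
Definition component_order s : rel nat :=
  tiebreak (fun k l => `[< le (representative s k) (representative s l) >]).

Lemma component_order_linear s : linear_rel (component_order s).
Proof.
have [_ _ trans tot] := hle; apply: tiebreak_linear.
- by move=> l k p /asboolP kl /asboolP lp; apply/asboolP; exact: trans kl lp.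
- move=> k l; apply/orP.
  by case: (tot (representative s k) (representative s l)) => h; [left|right];
    exact/asboolP.
Qed.

Lemma representativeP s x : s <~ x -> s <> x ->
  let x' := representative s (class s x) in
  [/\ s <~ x', s <> x', class s x' = class s x & meet rho x x' <> s].
Proof.
move=> sx xs /=; have [Ik Cx] := classP sx xs.
have Cx' : C s (class s x) (representative s (class s x)).
  by apply: (xgetPex rho); exists x.
have [sx' xs'] := class_anc Ik Cx'; have k := class_unique Ik Cx'.
by split => //; apply/class_meet.
Qed.

(** By [Or2_fork_move_l] and [Or2_fork_move_r] two points that fork at [s] compare
as the representatives of their components. *)
Lemma order_shuffle x y :
  le x y <-> shuffle rho I C (fun s k l => component_order s k l) x y.
Proof.
have [refl anti trans tot] := hle.
case: (fork_or_anc x y) => [xy|yx|f].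
- by split=> _; [exact: shuffle_anc|exact: h1].
- split=> [xy|].
    have -> : x = y by apply: anti => //; exact: h1.
    by apply: Or31.
  move/shuffle_cases => [xy|/fork_sym/fork_incomparable//].
  by apply: h1; exact: xy.
rewrite (shuffle_fork _ f); have [sx sy] := fork_anc f.
have nc := fork_class f; have [_ xs ys] := f.
move: f sx sy nc xs ys; set s := meet rho x y => f sx sy nc xs ys.
have [sx' xs' kx mx] := representativeP sx xs.
have [sy' ys' ky my] := representativeP sy ys.
have [_ fx] := fork_move f sx' xs' mx.
have [_ /fork_sym fxy] := fork_move (fork_sym fx) sy' ys' my.
have imp : le x y -> le (representative s (class s x)) (representative s (class s y)).
  move=> lxy; apply: (Or2_fork_move_r fx) => //.
  exact: (Or2_fork_move_l f).
have imp' : le y x -> le (representative s (class s y)) (representative s (class s x)).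
  move=> lyx; apply: (Or2_fork_move_l (fork_sym fx)) => //.
  exact: (Or2_fork_move_r (fork_sym f)).
have nle : le (representative s (class s x)) (representative s (class s y)) ->
    ~ le (representative s (class s y)) (representative s (class s x)).
  by move=> h h'; apply: nc; rewrite -kx -ky (anti _ _ h h').
rewrite /component_order /tiebreak; split=> [/imp lxy|/andP[/asboolP lxy _]].
  apply/andP; split; first exact/asboolP.
  by apply/implyP => /asboolP /(nle lxy).
by case: (tot x y) => // /imp' /(nle lxy).
Qed.

End Converse.

End TreeOrders.

(** * Finite families of independent uniform variables *)

Section IidUniform.
Import Order.TTheory GRing.Theory Num.Theory.
Import numFieldNormedType.Exports.
Local Open Scope ring_scope.

Context {d : measure_display} {Omega : measurableType d} {R : realType}.
Context (P : probability Omega R) (J : eqType) (D : set J) (X : J -> {RV P >-> R}).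
Context (hX : iid_uniform01 D X).

(** The sets that constrain the coordinates in [js] separately; they generate the
product sigma-algebra of these coordinates. *)
Definition boxes (js : seq J) : set (set (J -> R)) :=
  [set A | exists2 B : J -> set R, (forall j, measurable (B j)) &
                                   A = [set f | forall j, j \in js -> B j (f j)]].

Lemma boxes_setI_closed js : setI_closed (boxes js).
Proof.
move=> _ _ [B mB ->] [B' mB' ->]; exists (fun j => B j `&` B' j).
  by move=> j; exact: measurableI.
apply/seteqP; split=> [f [h h'] j js_j|f h]; first by split; auto.
by split=> j /h [].
Qed.

Lemma iid_box (js : seq J) (p : J -> J) (B : J -> set R) :
  uniq js -> {in js &, injective p} -> (forall j, j \in js -> D (p j)) ->
  (forall j, measurable (B j)) ->
  let E := [set w | forall j, j \in js -> B j (X (p j) w)] in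
  measurable E /\ P E = (\prod_(j <- js) uniform_prob (@ltr01 R) (B j))%E.
Proof.
move=> ujs pinj pD mB /=.
have [->|[j0 _]] : js = [::] \/ exists j0 : J, True;
  first by case: (js) => [|j ?]; [left|right; exists j].
  rewrite big_nil (_ : [set _ | _] = setT); last by apply/seteqP; split.
  by rewrite probability_setT; split.
(* [B'] is [B] read through the inverse of [p] on [map p js]. *)
pose B' j' := B (nth j0 js (index j' (map p js))).
have BE j : j \in js -> B' (p j) = B j.
  move=> jjs; rewrite /B' -(nth_index j0 jjs) -(nth_map j0 (p j0)) ?index_mem//.
  by rewrite index_uniq ?size_map ?index_mem ?map_inj_in_uniq.
have -> : [set w | forall j, j \in js -> B j (X (p j) w)] =
    \bigcap_(j in [set` map p js]) (X j @^-1` B' j).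
  apply/seteqP; split=> [w h _ /= /mapP[j jjs ->]|w h j jjs].
    by rewrite /preimage /= BE//; exact: h.
  by rewrite -BE//; apply: h => /=; exact: map_f.
split.
  apply: fin_bigcap_measurable; first exact: finite_seq.
  by move=> j _; apply: measurable_funPTI; exact: mB.
rewrite hX.1.
- rewrite big_map big_seq [RHS]big_seq; apply: eq_bigr => j jjs.
  by rewrite BE//; apply: (hX.2 _ (pD _ jjs)).
- by rewrite map_inj_in_uniq.
- by move=> _ /= /mapP[j jjs ->]; exact: pD.
- by move=> j; exact: mB.
Qed.

(** The joint law of finitely many members of the family does not depend on
which ones are taken: both laws agree on boxes, which generate the product
sigma-algebra and are stable under intersection. *)
Lemma iid_reindex (js : seq J) (p : J -> J) (A : set (J -> R)) :
  uniq js -> {in js &, injective p} ->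
  (forall j, j \in js -> D j) -> (forall j, j \in js -> D (p j)) ->
  <<s boxes js >> A ->
  [/\ measurable [set w | A (X^~ w)],
      measurable [set w | A (fun j => X (p j) w)] &
      P [set w | A (X^~ w)] = P [set w | A (fun j => X (p j) w)] ].
Proof.
move=> ujs pinj jsD pD.
rewrite -setI_closed_g_dynkin_g_sigma_algebra; last exact: boxes_setI_closed.
pose H := [set A : set (J -> R) | [/\ measurable [set w | A (X^~ w)],
      measurable [set w | A (fun j => X (p j) w)] &
      P [set w | A (X^~ w)] = P [set w | A (fun j => X (p j) w)] ] ].
suff : <<d boxes js >> `<=` H by exact.
apply: smallest_sub; last first.
  move=> _ [B mB ->].
  have [m1 e1] := @iid_box js id B ujs (in2W (@inj_id J)) jsD mB.
  have [m2 e2] := @iid_box js p B ujs pinj pD mB.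
  by split => //; rewrite e1 e2.
split.
- by split; [exact: measurableT|exact: measurableT|].
- move=> E [m1 m2 e]; split; [exact: measurableC|exact: measurableC|].
  by rewrite -[LHS]/(P (~` _)) -[RHS]/(P (~` _)) !probability_setC// e.
- move=> F tF HF.
  have E1 : [set w | (\bigcup_k F k) (X^~ w)] = \bigcup_k [set w | F k (X^~ w)].
    by [].
  have E2 : [set w | (\bigcup_k F k) (fun j => X (p j) w)] =
      \bigcup_k [set w | F k (fun j => X (p j) w)] by [].
  rewrite /H /= E1 E2.
  split; [by apply: bigcupT_measurable => k; have [] := HF k
         |by apply: bigcupT_measurable => k; have [] := HF k|].
  have tpre (g : Omega -> J -> R) : trivIset setT (fun k => [set w | F k (g w)]).
    by move=> i j _ _ [w [h h']]; apply: tF => //; exists (g w).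
  rewrite !measure_bigcup; [|by move=> k _; have [] := HF k|exact: tpre
    |by move=> k _; have [] := HF k|exact: tpre].
  by apply: eq_eseriesr => k _; have [] := HF k.
Qed.

Lemma sigma_boxes_ler (js : seq J) (j1 j2 : J) (b : bool) :
  j1 \in js -> j2 \in js ->
  <<s boxes js >> [set f : J -> R | (f j1 <= f j2) = b].
Proof.
move=> h1 h2.
have mproj j : j \in js -> measurable_fun setT
    (fun f : g_sigma_algebraType (boxes js) => f j).
  move=> hj _ B mB; rewrite setTI; apply: sub_sigma_algebra.
  exists (fun i => if i == j then B else setT); first by move=> i; case: ifP.
  apply/seteqP; split=> [f Bf i _|f /(_ j hj)]; last by rewrite eqxx.
  by case: eqP => [->|].
have := measurable_realfun.measurable_fun_ler (mproj _ h1) (mproj _ h2).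
by move=> /(_ measurableT [set b]); rewrite setTI; exact.
Qed.

Lemma sigma_boxes_pattern (js : seq J) (Q : J -> J -> Prop) (c : J -> J -> bool) :
  <<s boxes js >> [set f : J -> R | forall j1 j2, j1 \in js -> j2 \in js ->
     Q j1 j2 -> (f j1 <= f j2) = c j1 j2].
Proof.
rewrite (_ : [set f | _] = \bigcap_(j1 in [set` js])
    \bigcap_(j2 in [set j | j \in js /\ Q j1 j])
     [set f : J -> R | (f j1 <= f j2) = c j1 j2]); last first.
  apply/seteqP; split=> f h j1; first by move=> ? j2 [? ?]; exact: h.
  by move=> j2 h1 h2 Q12; exact: (h _ h1).
have fin j1 : finite_set [set j | j \in js /\ Q j1 j].
  by apply: sub_finite_set (finite_seq js) => j [].
apply: (@fin_bigcap_measurable _ (g_sigma_algebraType (boxes js))) => // j1 h1.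
apply: (@fin_bigcap_measurable _ (g_sigma_algebraType (boxes js))) => // j2 [h2 _].
exact: sigma_boxes_ler.
Qed.

Lemma iid_pattern_reindex (js : seq J) (p : J -> J) (Q : J -> J -> Prop)
    (c : J -> J -> bool) :
  uniq js -> {in js &, injective p} ->
  (forall j, j \in js -> D j) -> (forall j, j \in js -> D (p j)) ->
  P [set w | forall j1 j2, j1 \in js -> j2 \in js -> Q j1 j2 ->
             (X j1 w <= X j2 w) = c j1 j2] =
  P [set w | forall j1 j2, j1 \in js -> j2 \in js -> Q j1 j2 ->
             (X (p j1) w <= X (p j2) w) = c j1 j2].
Proof.
move=> ujs pinj jsD pD.
by have [] := iid_reindex ujs pinj jsD pD (@sigma_boxes_pattern js Q c).
Qed.

(** The joint law of [X j] and [X j'] is the product of their laws, under which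
the diagonal is null since the sections of the diagonal are single points. *)
Lemma iid_no_tie j j' : D j -> D j' -> j != j' ->
  P.-negligible [set w | X j w = X j' w].
Proof.
move=> Dj Dj' jj'.
pose XY w : R * R := (X j w, X j' w).
have mXY : measurable_fun setT XY by exact: measurable_fun_pair.
pose m1 := distribution P (X j); pose m2 := distribution P (X j').
pose mXYf : {mfun Omega >-> (R * R)%type} :=
  HB.pack XY (isMeasurableFun.Build _ _ _ _ XY mXY).
pose m' := distribution P mXYf.
have joint A B : measurable A -> measurable B -> m' (A `*` B) = (m1 A * m2 B)%E.
  move=> mA mB.
  pose BB i := if i == j then A else B.
  have := hX.1 [:: j; j'] BB; rewrite /= inE jj' => /(_ isT) h.
  rewrite /m' /distribution /pushforward /=.
  rewrite (_ : _ @^-1` _ = \bigcap_(i in [set` [:: j; j']]) (X i @^-1` BB i)).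
    rewrite h.
    - rewrite big_cons big_seq1 /BB eqxx eq_sym (negbTE jj').
      by [].
    - by move=> i /=; rewrite !inE => /orP[] /eqP ->.
    - by move=> i; rewrite /BB; case: ifP.
  apply/seteqP; split=> [w [/= Aw Bw] i /=|w h'].
    by rewrite !inE /BB /preimage => /orP[] /eqP ->;
      rewrite ?eqxx// eq_sym (negbTE jj').
  split.
    by have := h' j; rewrite /= !inE eqxx /BB eqxx; exact.
  by have := h' j'; rewrite /= !inE eqxx orbT /BB eq_sym (negbTE jj'); exact.
pose diag := [set u : R * R | u.1 = u.2].
have mdiag : measurable diag.
  have := measurable_realfun.measurable_fun_eqr
    (measurable_fst : measurable_fun [set: R * R] fst)
    (measurable_snd : measurable_fun [set: R * R] snd).
  move=> /(_ measurableT [set true]); rewrite setTI.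
  rewrite (_ : _ @^-1` _ = diag); first by apply.
  by apply/seteqP; split=> u /= /eqP.
apply/negligibleP; first by have := mXY measurableT _ mdiag; rewrite setTI.
transitivity ((m1 \x m2)%E diag); first by rewrite (product_measure_unique joint).
rewrite /product_measure1 integral0_eq// => x _ /=.
rewrite (_ : xsection diag x = [set x]).
  rewrite /m2 (hX.2 _ Dj')//.
  have /null_content_dominatesP dom := dominates_uniform_prob (@ltr01 R).
  by apply: dom => //; exact: lebesgue_measure_set1.
by apply/seteqP; split=> y; rewrite /xsection /= inE /diag /= => ->.
Qed.

End IidUniform.

(** * Linear orders and uniform distributions on finite sets *)

(** The isomorphism sends the element of rank [i] for [Q] to the one of rank [i]
for [Q']. *)
Lemma linear_rel_iso (Q Q' : rel nat) (ks : seq nat) :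
  uniq ks -> linear_rel Q -> linear_rel Q' ->
  exists f : nat -> nat,
    [/\ forall k, k \in ks -> f k \in ks, {in ks &, injective f} &
        {in ks &, forall k l, Q k l = Q' (f k) (f l)}].
Proof.
move=> uks.
have rank (L : rel nat) : linear_rel L ->
    {in ks &, forall k l, L k l = (index k (sort L ks) <= index l (sort L ks))%N}.
  move=> [anti trans tot] k l kks lks.
  have refl : reflexive L by move=> x; have := tot x x; rewrite orbb.
  have kS : k \in sort L ks by rewrite mem_sort.
  have lS : l \in sort L ks by rewrite mem_sort.
  apply/idP/idP => [Lkl|]; last first.
    exact: (sorted_leq_index trans refl (sort_sorted tot ks)).
  rewrite leqNgt; apply/negP => lt.
  have Llk := sorted_ltn_index trans (sort_sorted tot ks) _ _ lS kS lt.
  by move: lt; rewrite (anti k l) ?ltnn// Lkl.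
move=> lQ lQ'; pose f k := nth 0%N (sort Q' ks) (index k (sort Q ks)).
have lt k : k \in ks -> (index k (sort Q ks) < size (sort Q' ks))%N.
  by move=> kks; rewrite size_sort -(size_sort Q) index_mem mem_sort.
have fks k : k \in ks -> f k \in ks.
  by move=> kks; rewrite -(mem_sort Q'); apply: mem_nth; exact: lt.
have iso : {in ks &, forall k l, Q k l = Q' (f k) (f l)}.
  move=> k l kks lks; rewrite (rank _ lQ)// (rank _ lQ') ?fks//.
  by rewrite !index_uniq ?lt ?sort_uniq.
exists f; split => // k l kks lks e.
have [anti _ tot] := lQ; have [_ _ tot'] := lQ'.
apply: anti; rewrite !iso// e.
by have := tot' (f l) (f l); rewrite orbb => ->.
Qed.

Section FiniteUniform.
Import Order.TTheory GRing.Theory Num.Theory.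
Local Open Scope ring_scope.
Context {d : measure_display} {Omega : measurableType d} {R : realType}.

Lemma uniformly_distributed_of_symmetry (P : probability Omega R)
    (V : finType) (A : {set V}) (X : Omega -> V) :
  (forall v, measurable (X @^-1` [set v])) ->
  (forall v, v \notin A -> P (X @^-1` [set v]) = 0%E) ->
  (forall v v', v \in A -> v' \in A ->
     P (X @^-1` [set v]) = P (X @^-1` [set v'])) ->
  uniformly_distributed P A X.
Proof.
move=> mX X0 Xsym v; split => //; case: ifPn => vA; last exact: X0.
have total : (\sum_(u <- enum V) P (X @^-1` [set u]) = 1)%E.
  rewrite fsbig_seq ?enum_uniq// -measure_fin_bigcup.
  - rewrite (_ : \bigcup_(_ in _) _ = setT); first exact: probability_setT.
    by apply/seteqP; split=> // w _; exists (X w); rewrite //= mem_enum.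
  - exact: finite_seq.
  - by move=> i j _ _ [w [/= <- <-]].
  - by move=> u _; exact: mX.
have fin : P (X @^-1` [set v]) \is a fin_num by exact: fin_num_measure.
rewrite big_enum /= (bigID (mem A)) /= [X in (_ + X)%E]big1 ?adde0 in total; last first.
  by move=> u uA; exact: X0.
rewrite (eq_bigr (fun=> P (X @^-1` [set v]))) in total; last first.
  by move=> u uA; exact: Xsym.
move: total; rewrite -(fineK fin) sumEFin sumr_const => -[].
move: (fine _) => a e; rewrite -mulr_natr in e.
have A0 : #|A|%:R != 0 :> R
  by apply/eqP => z; move: e; rewrite z mulr0 => /esym/eqP; rewrite oner_eq0.
by congr EFin; rewrite -[LHS](mulfK A0) e mul1r.
Qed.

End FiniteUniform.

(** * The law of the shuffling *)

Section ShufflingLaw.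
Import Order.TTheory GRing.Theory Num.Theory.
Local Open Scope ring_scope.
Context {R : realType} {T : metricType R} (hT : real_tree T) (rho : T).
Context (I : T -> set nat) (C : T -> nat -> set T) (hC : component_enum rho I C).
Implicit Types (s x y : T).

Lemma components_neq s x y : x <> s -> y <> s -> segment x y s ->
  connected_component (~` [set s]) x <> connected_component (~` [set s]) y.
Proof.
move=> xs ys sxy e.
have : connected_component (~` [set s]) y y by exact: connected_component_refl.
by rewrite -e (component_segment hT xs) => -[_].
Qed.

(** The components of [x], of [y] and, unless [s = rho], of [rho] are distinct. *)
Lemma fork_branch_point s x y : fork rho s x y -> branch_points rho s \/ s = rho.
Proof.
move=> f; have [sx sy] := fork_anc hT f; have [m xs ys] := f.
have [->|/eqP rs] := eqVneq s rho; [by right|left; split => //].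
have sxy : segment x y s by rewrite -m; exact: meet_segment.
pose p k := nth rho [:: x; y; rho] k.
have ps k : (k < 3)%N -> p k <> s.
  by case: k => [|[|[|]]]// _; rewrite /p /=; exact: nesym.
have pinj : {in `I_3 &, injective (fun k => connected_component (~` [set s]) (p k))}.
  have lt k l : (k < l)%N -> (l < 3)%N ->
      connected_component (~` [set s]) (p k) <> connected_component (~` [set s]) (p l).
    move=> kl l3; apply: components_neq; [exact: ps (ltn_trans kl l3)|exact: ps|].
    by case: l l3 kl => [|[|[|]]]// _; case: k => [|[|]]// _; rewrite /p //=;
      exact: segment_sym.
  move=> k l; rewrite !inE /= => k3 l3 e.
  by case: (ltngtP k l) => // h; [case: (lt _ _ h l3)|case: (lt _ _ h k3)].
rewrite -(card_le_eql (inj_card_eq pinj)); apply: subset_card_le.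
by move=> _ [k k3 <-]; exists (p k) => //; exact: ps.
Qed.

Context (n : nat) (v : 'I_n -> T).

Lemma admissibleP r : r \in admissible_orderings rho v <->
  exists2 O : T -> rel nat, forall s, linear_rel (O s) &
    r = induced_ordering v (shuffle rho I C (fun s k l => O s k l)).
Proof.
rewrite inE; split=> [/asboolP [le [lin or1 or2 ->]]|[Q lin ->]].
  exists (component_order rho C le); first exact: component_order_linear.
  apply/ffunP => p; rewrite !ffunE.
  by congr `[< _ >]; apply/propext; exact: (order_shuffle hT hC lin or1 or2).
apply/asboolP; exists (shuffle rho I C (fun s k l => Q s k l)); split => //.
- exact: shuffle_linear.
- exact: shuffle_Or1.
- exact: shuffle_Or2.
Qed.

(** The component of [v i] above its meet with [v j].  This is only meaningful
when [v i] and [v j] fork there, as required in [keys]. *)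
Definition key (i j : 'I_n) : T * nat :=
  let m := meet rho (v i) (v j) in (m, class I C m (v i)).

Definition keys : seq (T * nat) := undup [seq key p.1 p.2 |
  p <- enum {: 'I_n * 'I_n} &
  `[< fork rho (meet rho (v p.1) (v p.2)) (v p.1) (v p.2) >]].

Lemma keysP s k : (s, k) \in keys <->
  exists i j, fork rho s (v i) (v j) /\ k = class I C s (v i).
Proof.
rewrite mem_undup; split=> [/mapP[[i j] /=]|[i [j [f ->]]]].
  rewrite mem_filter => /andP[/asboolP f _] [-> ->].
  by exists i, j.
have [m _ _] := f; apply/mapP; exists (i, j); last by rewrite /key /= m.
by rewrite mem_filter mem_enum andbT /= m; exact/asboolP.
Qed.

Lemma keys_index j : j \in keys -> shuffle_index rho I j.
Proof.
case: j => s k /keysP[i [j [f ->]]]; split; first exact: fork_branch_point f.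
have [sx _] := fork_anc hT f; case: f => _ xs _.
by have [] := classP hT hC sx xs.
Qed.

(** Two keys [(s, k)] and [(s, l)] with [k <> l] come from points [v i] and [v j]
that fork at [s], even if each key arose from a fork with another point. *)
Lemma induced_ordering_keys (O O' : T -> nat -> nat -> Prop) :
  induced_ordering v (shuffle rho I C O) = induced_ordering v (shuffle rho I C O')
  <-> (forall s k l, (s, k) \in keys -> (s, l) \in keys -> k <> l ->
        (O s k l <-> O' s k l)).
Proof.
split=> [e s k l /keysP[i [i' [f ->]]] /keysP[j [j' [f' ->]]] kl|e].
  have [si _] := fork_anc hT f; have [sj _] := fork_anc hT f'.
  have fij : fork rho s (v i) (v j).
    by case: f f' => _ xi _ [_ xj _]; exact: (class_fork hT hC si sj xi xj kl).
  rewrite -(shuffle_fork hT hC O fij) -(shuffle_fork hT hC O' fij).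
  move/ffunP : e => /(_ (i, j)); rewrite !ffunE /= => e.
  by split=> /asboolP; [rewrite e|rewrite -e] => /asboolP.
apply/ffunP => -[i j]; rewrite !ffunE /=; congr `[< _ >]; apply/propext.
case: (fork_or_anc hT rho (v i) (v j)) => [ij|ji|f].
- by split=> _; exact: shuffle_anc.
- by split=> /(shuffle_cases hT) [ij|/fork_sym/(fork_incomparable hT)//];
    exact: shuffle_anc.
rewrite !(shuffle_fork hT hC _ f); apply: e; last exact: fork_class f.
- by apply/keysP; exists i, j.
- by apply/keysP; exists j, i; split => //; exact: fork_sym.
Qed.

Context {d : measure_display} {Omega : measurableType d} (P : probability Omega R).
Context (U : T * nat -> {RV P >-> R}) (hU : iid_uniform01 (shuffle_index rho I) U).

Let ordering w := induced_ordering v (le_Sh rho I C U w).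

Let sibling (j1 j2 : T * nat) := j1.1 = j2.1 /\ j1.2 <> j2.2.

Let pattern (c : T * nat -> T * nat -> bool) := [set w |
  forall j1 j2, j1 \in keys -> j2 \in keys -> sibling j1 j2 ->
    (U j1 w <= U j2 w) = c j1 j2].

Lemma ordering_pattern (O : T -> rel nat) :
  ordering @^-1` [set induced_ordering v (shuffle rho I C (fun s k l => O s k l))]
  = pattern (fun j1 j2 => O j1.1 j1.2 j2.2).
Proof.
apply/seteqP; split=> w.
  move=> /= /induced_ordering_keys e [s k] [s' l] h1 h2 [/= ss' kl].
  by rewrite -ss' in h2 *; apply/idP/idP => /(e s k l h1 h2 kl).
move=> h; apply/induced_ordering_keys => s k l h1 h2 kl.
by have /= <- := h _ _ h1 h2 (conj erefl kl).
Qed.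

Lemma measurable_pattern c : measurable (pattern c).
Proof.
by have [] := iid_reindex hU (undup_uniq _) (in2W (@inj_id _)) keys_index keys_index
  (@sigma_boxes_pattern _ _ keys sibling c).
Qed.

(** If the event is not empty, then any sample of it provides the orders at each
[s] that describe it. *)
Lemma measurable_ordering r : measurable (ordering @^-1` [set r]).
Proof.
have [->|/set0P[w0 <-]] := eqVneq (ordering @^-1` [set r]) set0;
  first exact: measurable0.
by rewrite (ordering_pattern (fun s k l => U (s, k) w0 <= U (s, l) w0));
  exact: measurable_pattern.
Qed.

(** The permutation of the keys that, over each [s], is the isomorphism of
[linear_rel_iso]. *)
Lemma keys_reindex (O O' : T -> rel nat) :
  (forall s, linear_rel (O s)) -> (forall s, linear_rel (O' s)) ->
  exists p : T * nat -> T * nat,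
    [/\ {in keys &, injective p},
        forall j, (p j).1 = j.1,
        forall j, (j \in keys) -> p j \in keys,
        forall j, (j \in keys) -> exists2 j', j' \in keys & p j' = j &
        forall j1 j2, j1 \in keys -> j2 \in keys -> j1.1 = j2.1 ->
          O j1.1 j1.2 j2.2 = O' (p j1).1 (p j1).2 (p j2).2 ].
Proof.
move=> lO lO'.
pose ks s := [seq j.2 | j <- keys & j.1 == s].
have ksP s k : (k \in ks s) = ((s, k) \in keys).
  apply/mapP/idP => [[[s' k']]|h].
    by rewrite mem_filter /= => /andP[/eqP -> ?] ->.
  by exists (s, k) => //; rewrite mem_filter eqxx.
have uks s : uniq (ks s).
  rewrite map_inj_in_uniq ?filter_uniq ?undup_uniq// => -[s1 k1] [s2 k2].
  by rewrite !mem_filter /= => /andP[/eqP -> _] /andP[/eqP -> _] ->.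
have /choice[f hf] s := linear_rel_iso (uks s) (lO s) (lO' s).
pose p (j : T * nat) := (j.1, f j.1 j.2).
have pk j : j \in keys -> p j \in keys.
  case: j => s k h; rewrite -ksP; have [fks _ _] := hf s.
  by apply: fks; rewrite ksP.
have pinj : {in keys &, injective p}.
  move=> [s k] [s' k'] h h' [ss' e]; rewrite -{}ss' /= in h' e *.
  by have [_ finj _] := hf s; congr pair; apply: finj; rewrite ?ksP.
exists p; split => //.
  have sub : {subset map p keys <= keys} by move=> _ /mapP[j jk ->]; exact: pk.
  have umap : uniq (map p keys) by rewrite map_inj_in_uniq ?undup_uniq.
  have [|_ e] := uniq_min_size umap sub; first by rewrite size_map.
  by move=> j; rewrite -e => /mapP[j' ? ->]; exists j'.
move=> [s k] [s' k'] h h' /= e; rewrite -e in h' *.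
by have [_ _ iso] := hf s; apply: iso; rewrite ksP.
Qed.

Lemma pattern_symmetry (O O' : T -> rel nat) :
  (forall s, linear_rel (O s)) -> (forall s, linear_rel (O' s)) ->
  P (pattern (fun j1 j2 => O j1.1 j1.2 j2.2)) =
  P (pattern (fun j1 j2 => O' j1.1 j1.2 j2.2)).
Proof.
move=> lO lO'; have [p [pinj p1 pk psurj piso]] := keys_reindex lO lO'.
rewrite /pattern (iid_pattern_reindex hU sibling _ (undup_uniq _) pinj
  keys_index); last first.
  by move=> j /pk; exact: keys_index.
have psib j1 j2 : j1 \in keys -> j2 \in keys ->
    sibling j1 j2 <-> sibling (p j1) (p j2).
  move=> k1 k2; rewrite /sibling !p1; split=> -[e ne]; split => // e'; apply: ne.
    congr (_ .2); apply: pinj => //.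
    by rewrite (surjective_pairing (p j1)) (surjective_pairing (p j2)) !p1 e e'.
  congr (_ .2); congr p.
  by rewrite (surjective_pairing j1) (surjective_pairing j2) e e'.
congr (P _); apply/seteqP; split=> w h j1 j2.
  move=> /psurj[i1 k1 <-] /psurj[i2 k2 <-] /(psib _ _ k1 k2) sib.
  by rewrite h//; apply: piso => //; case: sib.
move=> k1 k2 sib; rewrite h ?pk//; last exact/(psib _ _ k1 k2).
by rewrite piso//; case: sib.
Qed.

Let key_pairs := [seq p <- [seq (j1, j2) | j1 <- keys, j2 <- keys] | p.1 != p.2].

Let key_pairsP j1 j2 :
  (j1, j2) \in key_pairs <-> [/\ j1 \in keys, j2 \in keys & j1 != j2].
Proof.
rewrite mem_filter /=.
split=> [/andP[ne /allpairsP[[i1 i2] /= [k1 k2 [e1 e2]]]]|[k1 k2 ne]].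
  by rewrite e1 e2 in ne *.
by rewrite ne; apply/allpairsP; exists (j1, j2).
Qed.

Lemma keys_no_tie : P.-negligible
  (\bigcup_(p in [set` key_pairs]) [set w | U p.1 w = U p.2 w]).
Proof.
rewrite bigcup_seq big_seq; elim/big_ind : _ => [||[j1 j2]].
- exact: negligible_set0.
- by move=> A B; exact: negligibleU.
by move=> /key_pairsP[k1 k2 ne]; exact: iid_no_tie (keys_index k1) (keys_index k2) ne.
Qed.

(** Without ties the variables rank the keys as a linear order on [nat], once ties
between other indices are broken. *)
Lemma ordering_admissible w :
  (forall j1 j2, j1 \in keys -> j2 \in keys -> j1 != j2 -> U j1 w <> U j2 w) ->
  ordering w \in admissible_orderings rho v.
Proof.
move=> ntie; apply/admissibleP.
exists (fun s => tiebreak (fun k l => U (s, k) w <= U (s, l) w)).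
  move=> s; apply: tiebreak_linear => [l k m|k l]; first exact: le_trans.
  exact: le_total.
apply/induced_ordering_keys => s k l h1 h2 kl; rewrite /tiebreak.
have {}ntie := ntie _ _ h1 h2; split=> [le|/andP[]//].
apply/andP; split => //; apply/implyP => ge; exfalso; apply: ntie.
  by apply/eqP => -[].
by apply/eqP; rewrite eq_le le ge.
Qed.

Lemma ordering_inadmissible r : r \notin admissible_orderings rho v ->
  P (ordering @^-1` [set r]) = 0%E.
Proof.
move=> rA; apply/negligibleP; first exact: measurable_ordering.
apply: negligibleS keys_no_tie => w /= wr; apply: contrapT => h.
move/negP: rA; apply; rewrite -wr; apply: ordering_admissible => j1 j2 h1 h2 ne e.
by apply: h; exists (j1, j2) => //=; apply/key_pairsP.
Qed.

Lemma ordering_uniform :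
  uniformly_distributed P (admissible_orderings rho v) ordering.
Proof.
apply: uniformly_distributed_of_symmetry.
- exact: measurable_ordering.
- exact: ordering_inadmissible.
move=> _ _ /admissibleP[Q lQ ->] /admissibleP[Q' lQ' ->].
by rewrite !ordering_pattern; exact: pattern_symmetry.
Qed.

End ShufflingLaw.

Theorem proposition2p7 (R : realType) (T : metricType R) (rho : T)
    (hT : real_tree T) (hcompact : compact [set: T])
    (I : T -> set nat) (C : T -> nat -> set T)
    (hC : component_enum rho I C)
    (d : measure_display) (Omega : measurableType d) (P : probability Omega R)
    (U : T * nat -> {RV P >-> R})
    (hU : iid_uniform01 (shuffle_index rho I) U)
    (n : nat) (v : 'I_n -> T) (hv : injective v) :
  uniformly_distributed P (admissible_orderings rho v)
    (fun w => induced_ordering v (le_Sh rho I C U w)).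
Proof. exact: ordering_uniform. Qed.
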